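(* Let $d \ge 3$ be an integer. Then for any $d$-regular graph $G$ on $n$ vertices, $$ q^*(G) \le \frac{\lambda(G)}{d}, $$ where $\lambda(G) = \max(|\lambda_2|, |\lambda_n|)$ and $\lambda_1 \ge \lambda_2 \ge \cdots \ge \lambda_n$ are the eigenvalues of the adjacency matrix of $G$. In particular, for random $d$-regular graphs, asymptotically almost surely (as $n\to\infty$) $$ q^*(\mathcal{G}_{n,d}) \le \frac{2}{\sqrt{d}}. $$
   Context: Graphs are finite and simple. Modularity: for a graph $G$ with at least one edge and a partition $\mathcal{A} = \{A_1,\dots,A_k\}$ of $V(G)$, $$q_{\mathcal{A}}(G) = \sum_{A \in \mathcal{A}} \left( \frac{e(A)}{|E(G)|} - \frac{(\sum_{v\in A}\deg(v))^2}{4|E(G)|^2}\right),$$ where $e(A) = |\{uv \in E(G): u,v\in A\}|$ is the number of edges inside $A$. The modularity of $G$ is $q^*(G) = \max_{\mathcal{A}} q_{\mathcal{A}}(G)$, the maximum over all partitions $\mathcal{A}$ of $V(G)$. $\mathcal{G}_{n,d}$ denotes the uniformly random (simple) $d$-regular graph on $n$ labelled vertices; asymptotics are for $n\to\infty$ with $d$ fixed, and $n$ even if $d$ is odd. An event holds asymptotically almost surely if its probability tends to $1$ as $n\to\infty$. *)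

(* Defs.v *)
From HB Require Import structures.
From mathcomp Require Import all_boot all_order all_algebra spectral complex.
From mathcomp Require Import all_classical all_reals all_analysis.

Set Implicit Arguments.
Unset Strict Implicit.
Unset Printing Implicit Defensive.

Import Order.TTheory GRing.Theory Num.Theory.
Import numFieldNormedType.Exports.

Local Open Scope classical_set_scope.
Local Open Scope ring_scope.

(* A finite simple graph on the labelled vertices 0, ..., n-1 is its set of
   edges, each edge being a set of exactly two vertices. *)
Record sgraph (n : nat) := SGraph {
  edges : {set {set 'I_n}};
  edgesP : [forall e in edges, #|e| == 2] }.

HB.instance Definition _ n := [isSub for @edges n].
HB.instance Definition _ n := [Finite of sgraph n by <:].

Section Graphs.
Context {n : nat}.
Implicit Types (G : sgraph n) (A : {set 'I_n}) (P : {set {set 'I_n}}).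

Definition adjacent G (u v : 'I_n) : bool := [set u; v]%SET \in edges G.

Definition deg G (v : 'I_n) : nat := #|[set u | adjacent G u v]%SET|.

Definition regular (d : nat) G : bool := [forall v, deg G v == d].

Definition edges_inside G A : nat := #|[set e in edges G | e \subset A]%SET|.

Definition volume G A : nat := (\sum_(v in A) deg G v)%N.

Definition modularity_of (R : realType) G P : R :=
  \sum_(A in P) ((edges_inside G A)%:R / #|edges G|%:R
                 - (volume G A)%:R ^+ 2 / (4 * #|edges G|%:R ^+ 2)).

Definition singletons : {set {set 'I_n}} := [set [set v]%SET | v : 'I_n]%SET.

(* The maximum over all partitions. The initial value of the iterated maximum
   is the value at one of these partitions, so it does not affect the result. *)
Definition modularity (R : realType) G : R :=
  \big[Num.max/modularity_of R G singletons]_(P | finset.partition P [set: 'I_n]%SET)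
     modularity_of R G P.

Definition adjacency_mx (R : realType) G : 'M[R]_n :=
  \matrix_(u, v) (adjacent G u v)%:R.

End Graphs.

Definition is_spectrum (R : realType) n (M : 'M[R]_n) (s : seq R) : Prop :=
  sorted >=%R s /\ char_poly M = \prod_(x <- s) ('X - x%:P).

(* The eigenvalues with multiplicity, in nonincreasing order; the default
   value [::] is never used for a symmetric matrix (spectrumP below). *)
Definition spectrum (R : realType) n (M : 'M[R]_n) : seq R :=
  xget [::] [set s | is_spectrum M s].

(* The sequence is indexed from 0, so its entries 1 and n-1 are the second
   and the last eigenvalue. *)
Definition lambda (R : realType) n (G : sgraph n) : R :=
  let s := spectrum (adjacency_mx R G) in Num.max `|s`_1| `|s`_n.-1|.

(* Probability that the uniformly random d-regular graph on n labelled vertices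
   satisfies E. It is meaningful when such graphs exist; otherwise it is 0. *)
Definition Pr_regular (R : realType) (d n : nat) (E : pred (sgraph n)) : R :=
  #|[set G : sgraph n | regular d G && E G]%SET|%:R
    / #|[set G : sgraph n | regular d G]%SET|%:R.

Definition aas_regular (R : realType) (d : nat)
    (E : forall n, pred (sgraph n)) : Prop :=
  Pr_regular R d (E n) @[n --> within [set n | odd d -> ~~ odd n] \oo]
    --> (1 : R).

Lemma singletons_partition n :
  finset.partition (@singletons n) [set: 'I_n]%SET.
Proof.
apply/and3P; split.
- apply/eqP/setP => x; rewrite inE; apply/bigcupP; exists [set x]%SET.
    exact: imset_f.
  by rewrite inE.
- apply/finset.trivIsetP => _ _ /imsetP[u _ ->] /imsetP[v _ ->] uv.
  by rewrite disjoints1 inE; apply: contra uv => /eqP ->.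
- apply/negP => /imsetP[v _ /finset.setP/(_ v)]; by rewrite !inE eqxx.
Qed.

Lemma adjacency_mx_sym (R : realType) n (G : sgraph n) :
  (adjacency_mx R G)^T = adjacency_mx R G.
Proof. by apply/matrixP => u v; rewrite !mxE /adjacent finset.setUC. Qed.

Section Spectrum.
Local Open Scope complex_scope.

Lemma symmetric_spectrum_ex (R : realType) n (M : 'M[R]_n) :
  M^T = M -> exists s, is_spectrum M s.
Proof.
move=> MT; pose iota := real_complex R.
pose N : 'M[R[i]]_n := map_mx iota M.
have Nh : N \is hermsymmx.
  apply/is_hermitianmxP; rewrite expr0 scale1r; apply/matrixP => i j.
  rewrite !mxE -[in RHS]MT mxE.
  by apply/esym/CrealP; rewrite complex_real.
have Nsp := orthomx_spectralP (hermitian_normalmx Nh).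
have /mxOverP spR := hermitian_spectral_diag_real Nh.
pose r := [seq complex.Re (spectral_diag N 0 i) | i : 'I_n].
exists (sort >=%R r); split.
  by apply: sort_sorted => x y; exact: le_total.
rewrite (perm_big r) /=; last by rewrite perm_sort.
apply: (map_poly_inj iota); rewrite map_char_poly -/N rmorph_prod /=.
have -> : char_poly N = char_poly (diag_mx (spectral_diag N)).
  rewrite [in LHS]Nsp; set P := spectralmx N; set D := diag_mx _.
  have Pu : P \in unitmx by exact: spectral_unit.
  rewrite /char_poly /char_poly_mx.
  have -> : 'X%:M - map_mx polyC (invmx P *m D *m P) =
    map_mx polyC (invmx P) *m ('X%:M - map_mx polyC D) *m map_mx polyC P.
    rewrite mulmxBr mulmxBl !map_mxM; congr (_ - _).
    rewrite -mulmxA -scalar_mxC mulmxA -map_mxM mulVmx //.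
    by rewrite map_mx1 mul1mx.
  rewrite !det_mulmx mulrAC -det_mulmx -map_mxM mulVmx // map_mx1 det1.
  by rewrite mul1r.
rewrite char_poly_trig ?diag_mx_is_trig //.
rewrite /r big_map big_enum /=; apply: eq_bigr => i _.
rewrite rmorphB /= map_polyX map_polyC /= mxE eqxx mulr1n.
by congr (_ - _%:P); rewrite /iota RRe_real.
Qed.

End Spectrum.

Lemma spectrumP (R : realType) n (M : 'M[R]_n) :
  M^T = M -> is_spectrum M (spectrum M).
Proof. by move=> /symmetric_spectrum_ex [s Ms]; apply: (xgetI _ Ms). Qed.

Lemma size_spectrum (R : realType) n (M : 'M[R]_n) :
  M^T = M -> size (spectrum M) = n.
Proof.
move=> /spectrumP [_] /(congr1 (fun p : {poly R} => size p)).
by rewrite size_char_poly size_prod_XsubC => -[].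
Qed.

(* Main.v *)
Require Import Defs.
From mathcomp Require Import all_boot all_order all_algebra.
From mathcomp Require Import perm sesquilinear spectral complex lra ring zify.
From mathcomp Require Import all_classical all_reals all_analysis.
Import Defs.

Set Implicit Arguments.
Unset Strict Implicit.
Unset Printing Implicit Defensive.

Import Order.TTheory GRing.Theory Num.Theory.
Import numFieldNormedType.Exports.
Local Open Scope ring_scope.

(** Let [G] be [d]-regular on [n] vertices and put
    [w u v = adjacent u v / (d * n) - 1 / n ^ 2]. The modularity of a partition
    is the sum of [w] over the ordered pairs of vertices in a common part
    ([modularity_of_regular]); the total sum of [w] is zero.

    The spectral bound. Up to the factor [1 / (d * n)], the matrix [w] is the
    adjacency matrix with its action on the constant vectors removed. Hence
    summing [w] over a part [A] evaluates the adjacency form at the projection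
    of the indicator of [A] orthogonal to the constants, which is at most
    [lambda] times [#|A|] ([expander_mixing]). The sizes of the parts add up to
    [n].

    The random bound is a first moment argument.

    - If every part is put on one of two sides by a fair coin, a pair from
      distinct parts ends up separated, in a given order, with probability 1/4.
      As [w] sums to zero, the modularity is at most 4 times the maximum over
      vertex sets [S] of [a * b - cut G S / (d * n)], where [a] and [b] are the
      densities of [S] and of its complement
      ([partition_sum_le_bipartition]). So it is enough that no [S] has a cut
      below [d * n * (a * b - Y)] with [Y = 1 / (2 * sqrt d)].

    - Fix [S]. Replacing an edge [uv] inside [S] and an edge [xy] outside [S] by
      [ux] and [vy] increases the cut by 2. Counting these switchings from both
      ends ([switching_inequality]) compares the numbers of regular graphs with
      cuts [c] and [c + 2]: with [x = (c + 2) / (d * n)] and [y = a * b - x],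
      their ratio is at most [x ^ 2 / (x ^ 2 + y)] up to lower order terms. As
      [x <= 1/4 - y], this is at most [exp (- 16 * y)]
      ([sqr_le_expR_drift]).

    - Multiplying these ratios from [y = Y] down to [y = 0], where [y] decreases
      by [2 / (d * n)] in each step, the exponents add up to
      [16 * (d * n / 2) * (Y ^ 2 / 2) = n]. So a random regular graph has such a
      small cut at [S] with probability at most [exp (O(1) - n)]
      ([small_cut_rare]), and the union bound over the [2 ^ n] sets [S] gives a
      probability of order [(2 / e) ^ n], which tends to 0. *)

(** * Edges and degrees *)

Section Degrees.
Context {n : nat}.
Implicit Types (G : sgraph n) (A S : {set 'I_n}) (P : {set {set 'I_n}}).

Lemma edge_card G (e : {set 'I_n}) : e \in edges G -> #|e| = 2.
Proof. by move=> eG; move/forall_inP: (edgesP G) => /(_ e eG)/eqP. Qed.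

Lemma adjacentC G u v : adjacent G u v = adjacent G v u.
Proof. by rewrite /adjacent finset.setUC. Qed.

Lemma adjacent_neq G u v : adjacent G u v -> u != v.
Proof. by move=> /edge_card; rewrite cards2; case: eqP. Qed.

Lemma deg_row G v : deg G v = (\sum_u adjacent G v u)%N.
Proof.
rewrite /deg -sum1dep_card [LHS]big_mkcond.
by apply: eq_bigr => u _; rewrite adjacentC; case: adjacent.
Qed.

Lemma regular_row d G : regular d G ->
  forall v, (\sum_u adjacent G v u)%N = d.
Proof. by move=> /forallP Gd v; rewrite -deg_row; apply/eqP. Qed.

Lemma set2_eq (p q a w : 'I_n) : p != q ->
  ([set a; w]%SET == [set p; q]%SET) =
  (a == q) && (w == p) || (a == p) && (w == q).
Proof.
move=> pq; apply/eqP/orP => [E|[/andP[/eqP-> /eqP->]|/andP[/eqP-> /eqP->]]//].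
  have [/eqP wp|wp] := boolP (w == p).
    left; rewrite andbT; move/finset.setP/(_ q): E; rewrite !inE eqxx orbT wp.
    by rewrite [q == p]eq_sym (negPf pq) orbF eq_sym.
  have [/eqP wq|wq] := boolP (w == q).
    right; rewrite andbT; move/finset.setP/(_ p): E; rewrite !inE eqxx wq.
    by rewrite (negPf pq) orbF eq_sym.
  by move/finset.setP/(_ w): E; rewrite !inE eqxx orbT (negPf wp) (negPf wq).
exact: finset.setUC.
Qed.

Lemma sum_pair_eq (p q w : 'I_n) : p != q ->
  (\sum_a ([set a; w]%SET == [set p; q]%SET) = (w == p) + (w == q))%N.
Proof.
move=> pq; under eq_bigr => a _ do rewrite set2_eq //.
case: (eqVneq w p) => [->|wp].
  rewrite (negPf pq) (bigD1 q) //= eqxx big1 ?addn0 // => a aq.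
  by rewrite (negPf aq) andbF.
case: (eqVneq w q) => [_|wq].
  rewrite (bigD1 p) //= eqxx orbT big1 // => a ap.
  by rewrite (negPf ap) andbF.
by rewrite big1 // => a _; rewrite !andbF.
Qed.

(** The edge with ends [p] and [q] is met at the ordered pairs [(p, q)] and
    [(q, p)]. *)
Lemma handshake G A :
  (2 * edges_inside G A = \sum_(u in A) \sum_(v in A) adjacent G u v)%N.
Proof.
rewrite /edges_inside mulnC -sum_nat_const.
transitivity (\sum_(e in [set e in edges G | e \subset A]%SET)
   \sum_(u in A) \sum_(v in A) ([set u; v]%SET == e))%N.
  apply: eq_bigr => e; rewrite inE => /andP[eG].
  have /eqP/cards2P[p [q [pq ->]]] := edge_card eG.
  rewrite finset.subUset !finset.sub1set => /andP[pA qA].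
  transitivity (\sum_(u in A) ((u == p) + (u == q)))%N.
    have sum1 w : w \in A -> (\sum_(u in A) (u == w) = 1)%N.
      move=> wA; rewrite (bigD1 w) //= eqxx big1 // => u /andP[_ /negPf->] //.
    by rewrite big_split /= !sum1.
  apply: eq_bigr => u uA; rewrite -sum_pair_eq // (bigID (mem A)) /=.
  rewrite [X in (_ + X)%N]big1 => [|v vA].
    by rewrite addn0; apply: eq_bigr => v _; rewrite finset.setUC.
  rewrite set2_eq //; case: (eqVneq v q) vA => [->|_]; rewrite ?qA //=.
  by case: (eqVneq v p) => [->|_]; rewrite ?pA.
rewrite exchange_big; apply: eq_bigr => u uA.
rewrite exchange_big; apply: eq_bigr => v vA /=.
have [uv|uv] := boolP (adjacent G u v).
  rewrite (bigD1 [set u; v]%SET) /= ?eqxx; last first.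
    by rewrite inE finset.subUset !finset.sub1set uA vA !andbT.
  by rewrite big1 // => e /andP[_ /negPf]; rewrite eq_sym => ->.
rewrite big1 // => e; rewrite inE => /andP[eG _].
by case: eqP => // E; rewrite -E in eG; rewrite /adjacent eG in uv.
Qed.

End Degrees.

(** * Symmetric matrices on the complement of an eigenvector *)

Section SpectralCoordinates.
Local Open Scope complex_scope.
Local Open Scope sesquilinear_scope.
Context {R : realType} {n : nat}.

Lemma char_poly_similar (F : fieldType) (P D : 'M[F]_n) : P \in unitmx ->
  char_poly (invmx P *m D *m P) = char_poly D.
Proof.
move=> Pu; rewrite /char_poly /char_poly_mx.
have -> : 'X%:M - map_mx polyC (invmx P *m D *m P) =
    map_mx polyC (invmx P) *m ('X%:M - map_mx polyC D) *m map_mx polyC P.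
  rewrite mulmxBr mulmxBl !map_mxM; congr (_ - _).
  by rewrite -mulmxA -scalar_mxC mulmxA -map_mxM mulVmx // map_mx1 mul1mx.
by rewrite !det_mulmx mulrAC -det_mulmx -map_mxM mulVmx // map_mx1 det1 mul1r.
Qed.

(** [w i x] is the coordinate of [x] along the [i]-th vector of a complex
    orthonormal eigenbasis, numbered in the order of [spectrum M]. *)
Lemma spectral_coordinates (M : 'M[R]_n) : M^T = M ->
  exists w : 'I_n -> 'rV[R]_n -> R[i],
    (forall x y, ((x *m y^T) 0 0)%:C = \sum_i w i x * (w i y)^*) /\
    (forall i a x, w i (a *: x) = a%:C * w i x) /\
    (forall i x, w i (x *m M) = ((spectrum M)`_i)%:C * w i x).
Proof.
move=> MT; pose iota := real_complex R; pose N : 'M[R[i]]_n := map_mx iota M.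
have Nh : N \is hermsymmx.
  apply/is_hermitianmxP; rewrite expr0 scale1r; apply/matrixP => i j.
  rewrite !mxE -[in RHS]MT mxE.
  by apply/esym/CrealP; rewrite complex_real.
have := orthomx_spectralP (hermitian_normalmx Nh).
have := spectral_unitarymx N.
have /mxOverP := hermitian_spectral_diag_real Nh.
set P := spectralmx N; set sp := spectral_diag N => spR Punit NE.
pose r i := complex.Re (sp 0 i).
have spE i : sp 0 i = (r i)%:C by rewrite /r RRe_real.
have Pu : P \in unitmx by exact: unitarymx_unit.
have [_ Mspec] := spectrumP MT.
have /tuple_permP[/= s Es] : perm_eq (spectrum M) [tuple r i | i < n].
  apply: prod_XsubC_eq; rewrite -Mspec; apply: (map_poly_inj iota).
  rewrite map_char_poly -/N NE char_poly_similar //.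
  rewrite char_poly_trig ?diag_mx_is_trig // rmorph_prod /= big_map big_enum /=.
  apply: eq_bigr => i _.
  by rewrite rmorphB /= map_polyX map_polyC /= mxE eqxx mulr1n -spE.
have sE (i : 'I_n) : (spectrum M)`_i = r (s i).
  by rewrite Es (nth_map i) ?size_enum_ord // tnth_mktuple nth_ord_enum.
exists (fun i x => (map_mx iota x *m P^t*) 0 (s i)); split; [|split].
  move=> x y.
  have -> : ((x *m y^T) 0 0)%:C = (map_mx iota (x *m y^T)) 0 0.
    by rewrite [RHS]mxE.
  rewrite map_mxM -[map_mx iota x in LHS](mulmxKtV _ Punit) //.
  rewrite -(mulmxA (_ *m _)) mxE.
  rewrite (reindex_inj (@perm_inj _ s)) /=; apply: eq_bigr => i _.
  congr (_ * _); rewrite !mxE rmorph_sum; apply: eq_bigr => j _ /=.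
  rewrite !mxE rmorphM /= conjCK mulrC; congr (_ * _).
  by apply/esym/CrealP; rewrite complex_real.
  by move=> i a x; rewrite map_mxZ -scalemxAl mxE.
move=> i x; rewrite map_mxM -/N {1}NE invmx_unitary //.
rewrite !mulmxA (mulmxtVK _ Punit).
by rewrite mul_mx_diag mxE spE sE mulrC.
Qed.
End SpectralCoordinates.

Section SpectralGap.
Local Open Scope complex_scope.
Context {R : realType} {n : nat}.

(** No eigenvalue but the one of index 0 can equal [mu], so the eigenvector [e]
    lies on the first axis of the eigenbasis. A vector orthogonal to [e] then
    has no first coordinate, so only eigenvalues bounded by [l] enter its
    form. *)
Lemma orthogonal_form_le (M : 'M[R]_n) (mu l : R) (e x : 'rV[R]_n) :
    M^T = M -> e != 0 -> e *m M = mu *: e -> x *m e^T = 0 ->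
    (forall i : 'I_n, (0 < i)%N ->
      (spectrum M)`_i <= l /\ (spectrum M)`_i < mu) ->
  (x *m M *m x^T) 0 0 <= l * (x *m x^T) 0 0.
Proof.
move=> MT e0 eM xe sl.
have [w [dotw [wZ eigw]]] := spectral_coordinates MT.
have we (i : 'I_n) : (0 < i)%N -> w i e = 0.
  move=> /sl[_ smu].
  have /eqP := eigw i e.
  rewrite eM wZ -subr_eq0 -mulrBl mulf_eq0 => /orP[|/eqP//].
  by rewrite -rmorphB /= (inj_eq (@complexI _)) subr_eq0 gt_eqF.
have wx (i : 'I_n) : i = 0%N :> nat -> w i x = 0.
  move=> i0.
  have split0 y : ((y *m e^T) 0 0)%:C = w i y * (w i e)^*.
    rewrite dotw (bigD1 i) //= big1 ?addr0 // => j ji.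
    rewrite we ?conjC0 ?mulr0 // lt0n; apply: contra ji => /eqP j0.
    by apply/eqP/val_inj; rewrite /= j0 i0.
  have := split0 x; rewrite xe mxE => /esym/eqP; rewrite mulf_eq0 conjC_eq0.
  case/orP=> /eqP // wie; have := split0 e; rewrite wie mul0r => ee.
  case/negP: e0; apply/eqP/rowP => j; rewrite mxE; apply/eqP.
  rewrite -sqrf_eq0; move: ee => /eqP; rewrite (inj_eq (@complexI _)) mxE.
  rewrite psumr_eq0 => [/allP/(_ j)|k _]; last by rewrite mxE -expr2 sqr_ge0.
  by rewrite mem_index_enum mxE -expr2 => /(_ isT).
rewrite -lecR rmorphM /= !dotw mulr_sumr; apply: ler_sum => i _.
rewrite eigw -mulrA -!normCK; have [i0|i0] := posnP i.
  by rewrite wx // normr0 expr0n !mulr0.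
by rewrite ler_wpM2r ?exprn_ge0 // lecR; case: (sl i i0).
Qed.
End SpectralGap.

(** * The spectral bound *)

Section Excess.
Context {R : realType} {n : nat}.
Implicit Types (G : sgraph n) (A S : {set 'I_n}) (P : {set {set 'I_n}}).

(** Entry of the modularity matrix of a regular graph: the normalized adjacency
    minus its average over all pairs of vertices. *)
Definition excess (d : nat) G (u v : 'I_n) : R :=
  (adjacent G u v)%:R / (d * n)%:R - 1 / n%:R ^+ 2.

Lemma regular_edges d G : regular d G -> (2 * #|edges G| = d * n)%N.
Proof.
move=> Gd; have -> : #|edges G| = edges_inside G [set: 'I_n]%SET.
  congr #|pred_of_set _|; apply/finset.setP => e.
  by rewrite inE finset.subsetT andbT.
rewrite handshake (eq_bigl xpredT) => [|u]; last by rewrite inE.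
under eq_bigr => u _.
  rewrite (eq_bigl xpredT) => [|v]; last by rewrite inE.
  rewrite (regular_row Gd); over.
by rewrite sum_nat_const card_ord mulnC.
Qed.

Lemma regular_volume d G A : regular d G -> volume G A = (d * #|A|)%N.
Proof.
move=> /forallP Gd; rewrite /volume mulnC -sum_nat_const.
by apply: eq_bigr => v _; apply/eqP.
Qed.

Lemma sum_excess d G A : (0 < d)%N -> (0 < n)%N ->
  \sum_(u in A) \sum_(v in A) excess d G u v =
  (2 * edges_inside G A)%:R / (d * n)%:R - (#|A|%:R / n%:R) ^+ 2.
Proof.
move=> d0 n0; rewrite handshake /excess.
under [LHS]eq_bigr => u _ do rewrite big_split /= sumrN -mulr_suml sumr_const.
rewrite big_split /= sumrN -mulr_suml sumr_const natr_sum.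
congr (_ / _ - _); first by apply: eq_bigr => u _; rewrite natr_sum.
by rewrite div1r -mulrnA -[LHS]mulr_natl natrM expr_div_n -expr2.
Qed.

Lemma modularity_of_regular d G P : (0 < d)%N -> (0 < n)%N -> regular d G ->
  modularity_of R G P =
  \sum_(A in P) \sum_(u in A) \sum_(v in A) excess d G u v.
Proof.
move=> d0 n0 Gd; apply: eq_bigr => A _.
rewrite sum_excess // (regular_volume _ Gd).
have E : #|edges G|%:R = (d * n)%:R / 2 :> R.
  by rewrite -(regular_edges Gd) natrM mulrAC mulfV ?mul1r // pnatr_eq0.
rewrite E !natrM.
have d1 : d%:R != 0 :> R by rewrite pnatr_eq0 -lt0n.
have n1 : n%:R != 0 :> R by rewrite pnatr_eq0 -lt0n.
by field; rewrite d1 n1.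
Qed.

Lemma partition_card_sum P : finset.partition P [set: 'I_n]%SET ->
  \sum_(A in P) #|A|%:R = n%:R :> R.
Proof.
by move=> /card_partition; rewrite cardsT card_ord -natr_sum => <-.
Qed.

(** The indicator of [A] is its mean [a] times the all-one vector [e] plus a
    vector [x] orthogonal to [e]. The part along [e] contributes [a ^ 2] to the
    normalized adjacency form, which is the term subtracted in [excess]; on [x]
    the form is at most [lambda] times the square of the length. If
    [lambda >= d], the bound already follows from the degrees, as at most
    [d * #|A|] ordered pairs in [A] are adjacent. *)
Lemma expander_mixing d G A : (0 < d)%N -> (1 < n)%N -> regular d G ->
  \sum_(u in A) \sum_(v in A) excess d G u v <=
  lambda R G / d%:R * (#|A|%:R / n%:R).
Proof.
move=> d0 n1 Gd; have n0 := ltnW n1.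
have dR : 0 < d%:R :> R by rewrite ltr0n.
have nR : 0 < n%:R :> R by rewrite ltr0n.
have [dl|ld] := leP (d%:R : R) (lambda R G).
  apply: (@le_trans _ _ (#|A|%:R / n%:R)); last first.
    by rewrite ler_peMl ?divr_ge0 // ler_pdivlMr ?mul1r.
  rewrite sum_excess // handshake.
  apply: (@le_trans _ _ ((d * #|A|)%:R / (d * n)%:R)).
    rewrite lerBlDr ler_wpDr ?sqr_ge0 //.
    rewrite ler_pM2r ?invr_gt0 ?ltr0n ?muln_gt0 ?d0 //.
    rewrite ler_nat mulnC -sum_nat_const; apply: leq_sum => u _.
    by rewrite -(regular_row Gd u) [leqRHS](bigID (mem A)) /= leq_addr.
  by rewrite !natrM -mulf_div divff ?mul1r ?gt_eqF.
pose a : R := #|A|%:R / n%:R.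
pose e : 'rV[R]_n := const_mx 1.
pose z : 'rV[R]_n := \row_v (v \in A)%:R.
pose x := z - a *: e.
pose M := adjacency_mx R G.
have MT : M^T = M by exact: adjacency_mx_sym.
have eM : e *m M = d%:R *: e.
  apply/rowP => v; rewrite !mxE mulr1 -(regular_row Gd v) natr_sum.
  by apply: eq_bigr => u _; rewrite !mxE mul1r adjacentC.
have sumA (f : 'I_n -> R) : \sum_u (u \in A)%:R * f u = \sum_(u in A) f u.
  rewrite [RHS]big_mkcond; apply: eq_bigr => u _.
  by case: (u \in A); rewrite ?mul1r ?mul0r.
have ze : (z *m e^T) 0 0 = #|A|%:R.
  rewrite mxE -[RHS]sumr_const -sumA.
  by apply: eq_bigr => u _; rewrite !mxE.
have zz : (z *m z^T) 0 0 = #|A|%:R.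
  rewrite mxE -[RHS]sumr_const -sumA.
  apply: eq_bigr => u _; rewrite !mxE.
  by case: (u \in A); rewrite ?mulr0 ?mulr1.
have ee : (e *m e^T) 0 0 = n%:R.
  rewrite mxE -[in RHS](card_ord n) -sumr_const.
  by apply: eq_bigr => u _; rewrite !mxE mulr1.
have zMz : (z *m M *m z^T) 0 0 = (2 * edges_inside G A)%:R.
  rewrite handshake natr_sum -sumA mxE.
  under eq_bigr => v _ do rewrite mxE mulr_suml.
  rewrite exchange_big; apply: eq_bigr => u _ /=.
  rewrite natr_sum -sumA mulr_sumr; apply: eq_bigr => v _.
  by rewrite !mxE -mulrA [_ * (v \in A)%:R]mulrC.
have ez : (e *m z^T) 0 0 = #|A|%:R.
  by rewrite -ze -[e *m _]trmxK trmx_mul trmxK [LHS]mxE.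
have an : a * n%:R = #|A|%:R by rewrite divfK ?gt_eqF.
have mx00 (p q : 'M[R]_1) : (p - a *: q) 0 0 = p 0 0 - a * q 0 0.
  by rewrite !mxE.
have xe : x *m e^T = 0.
  apply/matrixP => i j; rewrite !ord1 mulmxBl -scalemxAl mx00 ze ee an mxE.
  exact: subrr.
have xx : (x *m x^T) 0 0 = #|A|%:R - a * #|A|%:R.
  rewrite [in X in _ *m X]/x linearB linearZ /= mulmxBr -scalemxAr xe scaler0.
  by rewrite subr0 mulmxBl -scalemxAl mx00 zz ez.
have xMx : (x *m M *m x^T) 0 0 =
    (2 * edges_inside G A)%:R - d%:R * (a * #|A|%:R).
  have xMe : x *m M *m e^T = 0.
    rewrite -MT -mulmxA -trmx_mul eM linearZ /= -scalemxAr xe scaler0 //.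
  rewrite [in X in _ *m X]/x linearB linearZ /= mulmxBr -scalemxAr xMe scaler0.
  rewrite subr0 mulmxBl mulmxBl -!scalemxAl eM -!scalemxAl mx00 zMz.
  by rewrite mxE ez; congr (_ - _); ring.
have sz := size_spectrum MT.
have [ssort _] := spectrumP MT.
have := @orthogonal_form_le R n M d%:R (lambda R G) e x MT.
have e0 : e != 0.
  apply: contraTneq (n0) => e0; have := ee; rewrite e0 mul0mx mxE => /esym/eqP.
  by rewrite pnatr_eq0 => /eqP->.
move=> /(_ e0 eM xe) H.
have {H} : (x *m M *m x^T) 0 0 <= lambda R G * (x *m x^T) 0 0.
  apply: H => i i0; suff sl : (spectrum M)`_i <= lambda R G.
    by split => //; apply: le_lt_trans ld.
  apply: (@le_trans _ _ (spectrum M)`_1).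
    rewrite -[_ <= _]/((>=%R) (spectrum M)`_1 (spectrum M)`_i).
    apply: (sorted_leq_nth (T := R) _ _ 0 ssort) => //.
    - by move=> p q r pq qr; exact: le_trans qr pq.
    - by move=> p; exact: lexx.
    - by rewrite ?inE sz.
    - by rewrite ?inE sz.
  by apply: le_trans (ler_norm _) _; rewrite /lambda /= le_max lexx.
rewrite xMx xx sum_excess // => H.
have l0 : 0 <= lambda R G by rewrite /lambda /= le_max normr_ge0.
have dn0 : 0 < (d * n)%:R :> R by rewrite ltr0n muln_gt0 d0.
rewrite -(ler_pM2r dn0) mulrBl divfK ?gt_eqF // -/a.
have -> : lambda R G / d%:R * a * (d * n)%:R = lambda R G * #|A|%:R.
  by rewrite -an natrM; field; rewrite gt_eqF.
have -> : a ^+ 2 * (d * n)%:R = d%:R * (a * #|A|%:R).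
  by rewrite -an natrM; ring.
apply: le_trans H _; rewrite ler_wpM2l // lerBlDr ler_wpDr //.
by rewrite mulr_ge0 ?divr_ge0.
Qed.

(** The mixing bound is linear in [#|A|], and the parts have [n] vertices. *)
Lemma modularity_le_lambda d G : (3 <= d)%N -> regular d G ->
  modularity R G <= lambda R G / d%:R.
Proof.
move=> d3 Gd; have d0 : (0 < d)%N by exact: leq_trans d3.
suff H P : finset.partition P [set: 'I_n]%SET ->
    modularity_of R G P <= lambda R G / d%:R.
  by apply: bigmax_le => [|P]; apply: H; exact: singletons_partition.
move=> partP; have [n0|n0] := posnP n.
  have l0 : 0 <= lambda R G by rewrite /lambda /= le_max normr_ge0.
  rewrite /modularity_of big1 ?divr_ge0 // => A _.
  have : (2 * #|edges G| = 0)%N.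
    by rewrite (regular_edges Gd); apply/eqP; rewrite muln_eq0 n0 eqxx orbT.
  move/eqP; rewrite muln_eq0 /= => /eqP->.
  by rewrite expr0n !mulr0 !invr0 !mulr0 subrr.
have n1 : (1 < n)%N.
  apply: leq_trans (_ : (d <= n)%N); first exact: leq_trans d3.
  rewrite -(regular_row Gd (Ordinal n0)) -[leqRHS]card_ord -sum1_card.
  by apply: leq_sum => u _; case: adjacent.
rewrite (modularity_of_regular P d0 n0 Gd).
apply: (@le_trans _ _ (\sum_(A in P) lambda R G / d%:R * (#|A|%:R / n%:R))).
  by apply: ler_sum => A _; exact: expander_mixing.
rewrite -mulr_sumr -mulr_suml partition_card_sum // divff ?mulr1 //.
by rewrite pnatr_eq0 -lt0n.
Qed.

End Excess.

(** * Random bipartitions *)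

(** The values at [a] and [b] are forced and the others are free. *)
Lemma card_ffun_separating (T : finType) (a b : T) : a != b ->
  (4 * \sum_(h : {ffun T -> bool}) (h a && ~~ h b) = #|{ffun T -> bool}|)%N.
Proof.
move=> ab; have ba : b != a by rewrite eq_sym.
pose F (i : T) (x : bool) : nat :=
  if i == a then nat_of_bool x
  else if i == b then nat_of_bool (~~ x) else 1%N.
transitivity (4 * \sum_(h : {ffun T -> bool}) \prod_i F i (h i))%N.
  congr (_ * _)%N; apply: eq_bigr => h _.
  rewrite (bigD1 a) //= (bigD1 b) //= big1 => [|i /andP[/negPf ia /negPf ib]].
    by rewrite /F !eqxx (negPf ba) muln1 mulnb.
  by rewrite /F ia ib.
rewrite -bigA_distr_bigA card_ffun card_bool -prod_nat_const.
rewrite (bigD1 a) //= (bigD1 b) //=.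
rewrite [RHS](bigD1 a) //= [X in (2 * X)%N](bigD1 b) //=.
rewrite !mulnA; congr (_ * _)%N.
  by rewrite /F !big_bool /= !eqxx (negPf ba).
by apply: eq_bigr => i /andP[/negPf ia /negPf ib]; rewrite /F big_bool ia ib.
Qed.

(** Average over all ways [h] to put the parts on two sides. A pair of vertices
    in distinct parts is separated, in the given order, by a quarter of them,
    and the sum of [w] over such pairs is minus its sum over the pairs in a
    common part. *)
Lemma partition_sum_le_bipartition (R : realType) (n : nat)
    (w : 'I_n -> 'I_n -> R) (Y : R) (P : {set {set 'I_n}}) :
    finset.partition P [set: 'I_n]%SET -> \sum_u \sum_v w u v = 0 ->
    (forall S : {set 'I_n}, - (\sum_(u in S) \sum_(v in ~: S) w u v) <= Y) ->
  \sum_(A in P) \sum_(u in A) \sum_(v in A) w u v <= 4 * Y.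
Proof.
move=> partP w0 wY.
pose H : finType := {ffun {set 'I_n} -> bool}.
pose p := finset.pblock P.
have pP v : p v \in P.
  by rewrite pblock_mem // (cover_partition partP) inE.
have /and3P[_ tP _] := partP.
have inp A u : A \in P -> (u \in A) = (p u == A).
  move=> AP; apply/idP/eqP => [uA|<-].
    exact: def_pblock.
  by rewrite mem_pblock (cover_partition partP) inE.
have qE : \sum_(A in P) \sum_(u in A) \sum_(v in A) w u v =
    \sum_u \sum_(v | p u == p v) w u v.
  rewrite [RHS](eq_bigl (fun u => u \in [set: 'I_n]%SET)) => [|u];
    last by rewrite finset.in_setT.
  rewrite (set_partition_big _ partP) /=.
  apply: eq_bigr => A AP; apply: eq_bigr => u uA; apply: eq_bigl => v.
  by rewrite inp // eq_sym; move: uA; rewrite inp // => /eqP->.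
pose S (h : H) := [set v | h (p v)]%SET.
have H0 : 0 < #|H|%:R :> R by rewrite ltr0n card_ffun expn_gt0 card_bool.
pose X h := \sum_(u in S h) \sum_(v in ~: S h) w u v.
have sumX : \sum_h 4 * - X h = #|H|%:R * \sum_u \sum_(v | p u == p v) w u v.
  have XE h : X h = \sum_u \sum_v (h (p u) && ~~ h (p v))%:R * w u v.
    rewrite /X big_mkcond; apply: eq_bigr => u _; rewrite inE.
    case: (h (p u)) => /=; last by rewrite big1 // => v _; rewrite mul0r.
    rewrite big_mkcond; apply: eq_bigr => v _; rewrite !inE.
    by case: (h (p v)); rewrite ?mul0r ?mul1r.
  rewrite -mulr_sumr sumrN; under eq_bigr => h _ do rewrite XE.
  have same : \sum_u \sum_(v | p u == p v) w u v =
      - \sum_u \sum_(v | p u != p v) w u v.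
    apply/eqP; rewrite -addr_eq0 -big_split -[X in _ == X]w0; apply/eqP.
    by apply: eq_bigr => u _; rewrite [RHS](bigID (fun v => p u == p v)).
  rewrite same !mulrN; congr (- _); rewrite exchange_big !mulr_sumr.
  apply: eq_bigr => u _; rewrite exchange_big !mulr_sumr [RHS]big_mkcond.
  apply: eq_bigr => v _ /=; rewrite -mulr_suml mulrA -natr_sum -natrM.
  case: eqVneq => [->|uv] /=; last by rewrite card_ffun_separating.
  by rewrite big1 ?mul0r ?mulr0 ?mul0r // => h _; rewrite andbN.
rewrite qE -(ler_pM2l H0) -sumX [leRHS]mulr_natl -sumr_const.
apply: ler_sum => h _; rewrite ler_wpM2l //; exact: wY.
Qed.

(** * Switchings *)

Section Switching.
Context {n : nat}.
Implicit Types (G : sgraph n) (S : {set 'I_n}) (D : {set {set 'I_n}}).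

Definition cut G S : nat := (\sum_(u in S) \sum_(v in ~: S) adjacent G u v)%N.

Definition inner G S : nat := (\sum_(u in S) \sum_(v in S) adjacent G u v)%N.

Lemma cutC G S : cut G (~: S) = cut G S.
Proof.
rewrite /cut finset.setCK exchange_big; apply: eq_bigr => u _.
by apply: eq_bigr => v _; rewrite adjacentC.
Qed.

Lemma inner_cut d G S : regular d G -> (inner G S + cut G S = d * #|S|)%N.
Proof.
move=> Gd; rewrite -big_split /= mulnC -sum_nat_const; apply: eq_bigr => u _.
rewrite -(regular_row Gd u) [RHS](bigID (mem S)) /=; congr (_ + _)%N.
by apply: eq_bigl => v; rewrite inE.
Qed.

(** Symmetric difference with [D] in place of a removal and an insertion: it is
    an involution, so switching is injective without any condition on the graph.
    The restriction to pairs keeps the result a graph for every [D]. *)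
Definition toggled D (E : {set {set 'I_n}}) : {set {set 'I_n}} :=
  [set e | (e \in E) (+) (e \in D) & #|e| == 2]%SET.

Lemma toggledP D G : [forall e in toggled D (edges G), #|e| == 2].
Proof. by apply/forall_inP => e; rewrite inE => /andP[]. Qed.

Definition toggle D G : sgraph n := SGraph (toggledP D G).

Lemma toggleK D : involutive (toggle D).
Proof.
move=> G; apply: val_inj; apply/finset.setP => e; rewrite !inE.
have [e2|e2] /= := boolP (#|e| == 2); first by rewrite !andbT addbK.
by rewrite !andbF; apply/esym/negP => /edge_card/eqP; rewrite (negPf e2).
Qed.

Definition switch (u v x y : 'I_n) : sgraph n -> sgraph n :=
  toggle [set [set u; v]; [set x; y]; [set u; x]; [set v; y]]%SET.

(** Under these conditions toggling removes [uv] and [xy] and inserts [ux] and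
    [vy]. *)
Definition switchable G (u v x y : 'I_n) : bool :=
  [&& adjacent G u v, adjacent G x y, ~~ adjacent G u x & ~~ adjacent G v y].

Section OneSwitch.
Variables (S : {set 'I_n}) (u v x y : 'I_n) (G : sgraph n).
Hypotheses (uS : u \in S) (vS : v \in S) (xS : x \in ~: S) (yS : y \in ~: S).
Hypothesis (sw : switchable G u v x y).

Let neqSC p q : p \in S -> q \in ~: S -> p != q.
Proof. by move=> pS; rewrite inE; apply: contraNneq => <-. Qed.

(** Additive form, to be summed over a neighbourhood or across a cut. *)
Lemma switch_adjacent a b :
  (adjacent (switch u v x y G) a b +
     (([set a; b]%SET == [set u; v]%SET) + ([set a; b]%SET == [set x; y]%SET)) =
   adjacent G a b +
     (([set a; b]%SET == [set u; x]%SET) + ([set a; b]%SET == [set v; y]%SET)))%N.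
Proof.
have /and4P[uv xy ux vy] := sw.
have uvn := adjacent_neq uv; have xyn := adjacent_neq xy.
have uxn := neqSC uS xS; have vyn := neqSC vS yS.
have uyn := neqSC uS yS; have vxn := neqSC vS xS.
rewrite /adjacent /= !inE; move: [set a; b]%SET => e.
have [->|euv] := eqVneq e [set u; v]%SET.
  rewrite !set2_eq // (negPf uxn) (negPf uyn) (negPf uvn) eqxx (negPf vxn) /=.
  by rewrite -[_ \in _]/(adjacent G u v) uv.
have [->|exy] := eqVneq e [set x; y]%SET.
  rewrite !set2_eq // [x == u]eq_sym [y == u]eq_sym [x == v]eq_sym.
  rewrite (negPf uxn) (negPf uyn) (negPf vxn).
  rewrite [y == x]eq_sym (negPf xyn) andbF /=.
  by rewrite -[_ \in _]/(adjacent G x y) xy.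
have [->|eux] := eqVneq e [set u; x]%SET.
  rewrite !set2_eq // (negPf uyn) (negPf uvn) /=.
  by rewrite -[_ \in _]/(adjacent G u x) (negPf ux) cards2 uxn.
have [->|evy] := eqVneq e [set v; y]%SET.
  by rewrite -[_ \in _]/(adjacent G v y) (negPf vy) cards2 vyn.
rewrite /= addbF; case eG : (e \in edges G) => //=.
by rewrite (edge_card eG).
Qed.

(** Each of the four vertices loses one neighbour and gains one. *)
Lemma switch_regular d : regular d G -> regular d (switch u v x y G).
Proof.
have /and4P[uv xy ux vy] := sw.
have uvn := adjacent_neq uv; have xyn := adjacent_neq xy.
have uxn := neqSC uS xS; have vyn := neqSC vS yS.
move=> Gd; apply/forallP => w; apply/eqP; rewrite deg_row -(regular_row Gd w).
have : (\sum_a (adjacent (switch u v x y G) a w +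
     (([set a; w]%SET == [set u; v]%SET) + ([set a; w]%SET == [set x; y]%SET))) =
   \sum_a (adjacent G a w +
     (([set a; w]%SET == [set u; x]%SET) + ([set a; w]%SET == [set v; y]%SET))))%N.
  by apply: eq_bigr => a _; rewrite switch_adjacent.
(* Both corrections count how often [w] is one of [u], [v], [x], [y]. *)
rewrite !big_split /= !sum_pair_eq // [X in (_ + X = _)%N]addnACA => /addIn E.
rewrite (eq_bigr _ (fun a _ => congr1 nat_of_bool (adjacentC _ w a))) E.
by apply: eq_bigr => a _; rewrite adjacentC.
Qed.

(** Both inserted edges cross the cut and both removed ones do not. *)
Lemma switch_cut : cut (switch u v x y G) S = (cut G S + 2)%N.
Proof.
have /and4P[uv xy ux vy] := sw.
have uvn := adjacent_neq uv; have xyn := adjacent_neq xy.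
have uxn := neqSC uS xS; have vyn := neqSC vS yS.
have crossing p q : p \in S -> q \in ~: S ->
    (\sum_(a in S) \sum_(b in ~: S) ([set a; b]%SET == [set p; q]%SET) = 1)%N.
  move=> pS qS; have pq := neqSC pS qS.
  rewrite (bigD1 p) //= (bigD1 q) //= eqxx.
  rewrite !big1 // => [a /andP[aS ap]|b /andP[bS bq]].
    apply: big1 => b bS; rewrite set2_eq // (negPf ap) andFb orbF.
    by rewrite (negPf (neqSC aS qS)).
  by rewrite set2_eq // (negPf bq) (negPf pq) andbF.
have inside p q : (p \in S) = (q \in S) -> p != q ->
    (\sum_(a in S) \sum_(b in ~: S) ([set a; b]%SET == [set p; q]%SET) = 0)%N.
  move=> pqS pq; apply: big1 => a aS; apply: big1 => b; rewrite inE => bS.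
  apply/eqP; rewrite eqb0; apply/negP; rewrite set2_eq // => /orP[].
    by case/andP=> /eqP aq /eqP bp; move: aS bS; rewrite aq bp pqS => ->.
  by case/andP=> /eqP ap /eqP bq; move: aS bS; rewrite ap bq pqS => ->.
have : (\sum_(a in S) \sum_(b in ~: S)
     (adjacent (switch u v x y G) a b +
      (([set a; b]%SET == [set u; v]%SET) + ([set a; b]%SET == [set x; y]%SET))) =
   \sum_(a in S) \sum_(b in ~: S) (adjacent G a b +
      (([set a; b]%SET == [set u; x]%SET) + ([set a; b]%SET == [set v; y]%SET))))%N.
  by do 2!apply: eq_bigr => ? _; rewrite switch_adjacent.
have split3 (f g h : 'I_n -> 'I_n -> nat) :
    (\sum_(a in S) \sum_(b in ~: S) (f a b + (g a b + h a b)) =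
     \sum_(a in S) \sum_(b in ~: S) f a b +
      (\sum_(a in S) \sum_(b in ~: S) g a b +
       \sum_(a in S) \sum_(b in ~: S) h a b))%N.
  by rewrite -!big_split; apply: eq_bigr => a _; rewrite -!big_split.
rewrite !split3 (crossing _ _ uS xS) (crossing _ _ vS yS).
rewrite (inside u v) ?uS ?vS // (inside x y) //.
  by rewrite !addn0 /cut => ->.
by move: xS yS; rewrite !inE => /negPf-> /negPf->.
Qed.

Lemma switch_crossing :
  adjacent (switch u v x y G) u x && adjacent (switch u v x y G) v y.
Proof.
have /and4P[uv xy ux vy] := sw.
rewrite /adjacent /= !inE !eqxx !orbT !cards2.
rewrite -[[set u; x]%SET \in _]/(adjacent G u x) (negPf ux).
rewrite -[[set v; y]%SET \in _]/(adjacent G v y) (negPf vy).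
by rewrite !neqSC.
Qed.

End OneSwitch.

Definition cut_class (d : nat) S (c : nat) : {set sgraph n} :=
  [set G | regular d G & cut G S == c]%SET.

(** A fixed switching maps the graphs that admit it injectively to graphs in
    which [ux] and [vy] are edges. *)
Lemma cut_class_switch d S c (u v x y : 'I_n) :
    u \in S -> v \in S -> x \in ~: S -> y \in ~: S ->
  (\sum_(G in cut_class d S c) switchable G u v x y <=
   \sum_(G in cut_class d S (c + 2)) adjacent G u x * adjacent G v y)%N.
Proof.
move=> uS vS xS yS.
have -> : (\sum_(G in cut_class d S c) switchable G u v x y =
    #|[set G in cut_class d S c | switchable G u v x y]%SET|)%N.
  rewrite -sum1dep_card big_mkcondr; apply: eq_bigr => G _.
  by case: switchable.
have -> : (\sum_(G in cut_class d S (c + 2)) adjacent G u x * adjacent G v y =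
    #|[set G in cut_class d S (c + 2) | adjacent G u x && adjacent G v y]%SET|)%N.
  rewrite -sum1dep_card big_mkcondr; apply: eq_bigr => G _.
  by rewrite mulnb; case: (_ && _).
rewrite -(card_imset _ (can_inj (toggleK _ : involutive (switch u v x y)))).
apply/subset_leq_card/fintype.subsetP => _ /imsetP[G + ->].
rewrite !inE => /andP[/andP[Gd /eqP <-] sw].
by rewrite (switch_regular uS vS xS yS) // (switch_cut uS vS xS yS) // eqxx
  (switch_crossing uS vS xS yS).
Qed.

(** An ordered choice of an edge [uv] inside [S] and an edge [xy] outside fails
    to admit a switching only if [u x y] or [v y x] is a path. For given [u] and
    [v] there are at most [d ^ 2] paths of each kind. *)
Lemma switchable_count d G S : regular d G ->
  (inner G S * inner G (~: S) <=
   \sum_(u in S) \sum_(v in S) \sum_(x in ~: S) \sum_(y in ~: S)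
     switchable G u v x y + 2 * (inner G S * d ^ 2))%N.
Proof.
move=> Gd.
pose blocked u v x y :=
  (adjacent G u v * (adjacent G u x * adjacent G x y))%N.
have blocked_le : (\sum_(u in S) \sum_(v in S) \sum_(x in ~: S) \sum_(y in ~: S)
    blocked u v x y <= inner G S * d ^ 2)%N.
  rewrite /inner big_distrl; apply: leq_sum => u _ /=.
  rewrite big_distrl; apply: leq_sum => v _ /=.
  under eq_bigr => x _ do rewrite -big_distrr -big_distrr /=.
  rewrite -big_distrr leq_mul2l; apply/orP; right.
  rewrite expnS expn1 -{1}(regular_row Gd u) big_distrl /=.
  rewrite [leqRHS](bigID (mem (~: S))) /=; apply: leq_trans (leq_addr _ _).
  apply: leq_sum => x _; rewrite leq_mul2l -(regular_row Gd x).
  apply/orP; right.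
  by rewrite [leqRHS](bigID (mem (~: S))) /= leq_addr.
have -> : (2 * (inner G S * d ^ 2) =
    inner G S * d ^ 2 + inner G S * d ^ 2)%N.
  by rewrite mul2n addnn.
apply: leq_trans (leq_add (leqnn _) (leq_add blocked_le blocked_le)).
have swap : (\sum_(u in S) \sum_(v in S) \sum_(x in ~: S) \sum_(y in ~: S)
      blocked u v x y =
    \sum_(u in S) \sum_(v in S) \sum_(x in ~: S) \sum_(y in ~: S)
      blocked v u y x)%N.
  rewrite exchange_big; do 2!apply: eq_bigr => ? _; exact: exchange_big.
rewrite {2}swap -!big_split /= [leqLHS]big_distrl; apply: leq_sum => u _ /=.
rewrite -!big_split /= big_distrl; apply: leq_sum => v _ /=.
rewrite -!big_split /= big_distrr; apply: leq_sum => x _ /=.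
rewrite -!big_split /= big_distrr; apply: leq_sum => y _ /=.
rewrite /blocked /switchable.
rewrite [adjacent G v u]adjacentC [adjacent G y x]adjacentC.
by do 4!case: adjacent.
Qed.

(** Count the pairs of a graph and a switching of it from both ends: a graph
    with cut [c + 2] arises from at most [(c + 2) ^ 2] switchings, one for each
    ordered pair of edges across the cut. *)
Lemma switching_inequality (R : realType) d S c :
  #|cut_class d S c|%:R *
    (((d * #|S|)%:R - c%:R) * ((d * #|~: S|)%:R - c%:R - 2 * d%:R ^+ 2))
  <= #|cut_class d S (c + 2)|%:R * (c%:R + 2) ^+ 2 :> R.
Proof.
pose sumQ (f : 'I_n -> 'I_n -> 'I_n -> 'I_n -> nat) :=
  (\sum_(u in S) \sum_(v in S) \sum_(x in ~: S) \sum_(y in ~: S) f u v x y)%N.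
apply: (@le_trans _ _ (\sum_(G in cut_class d S c) sumQ (switchable G))%:R).
  rewrite natr_sum mulr_natl -sumr_const; apply: ler_sum => G.
  rewrite inE => /andP[Gd /eqP cG].
  have := switchable_count S Gd; rewrite -/(sumQ _).
  have := inner_cut S Gd; have := inner_cut (~: S) Gd; rewrite cutC cG.
  move=> <- <-; rewrite !natrD !addrK -(ler_nat R) natrD !natrM expr2.
  lra.
have -> : (c%:R + 2) ^+ 2 = ((c + 2) * (c + 2))%:R :> R.
  by rewrite natrM natrD expr2.
rewrite -natrM ler_nat -sum_nat_const.
apply: (@leq_trans (\sum_(G in cut_class d S (c + 2))
    sumQ (fun u v x y => adjacent G u x * adjacent G v y)%N)).
  rewrite /sumQ exchange_big [leqRHS]exchange_big; apply: leq_sum => u uS /=.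
  rewrite exchange_big [leqRHS]exchange_big; apply: leq_sum => v vS /=.
  rewrite exchange_big [leqRHS]exchange_big; apply: leq_sum => x xS /=.
  rewrite exchange_big [leqRHS]exchange_big; apply: leq_sum => y yS /=.
  exact: cut_class_switch.
apply: leq_sum => G; rewrite inE => /andP[_ /eqP <-].
rewrite /sumQ /cut big_distrlr /=; apply: leq_sum => u _; apply: leq_sum => v _.
by rewrite big_distrlr.
Qed.

End Switching.

(** * Small cuts are rare *)

(** The difference of the two sides vanishes at 0 and has the derivative
    [1 - (1 - 2 * z) * expR (2 * z)], which is nonnegative because
    [1 - 2 * z <= expR (- (2 * z))]. *)
Lemma mobius_le_expR (R : realType) (z : R) :
  0 <= z -> (1 - z) * expR (2 * z) <= 1 + z.
Proof.
move=> z0; rewrite -subr_ge0.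
pose h (x : R) := 1 + x - (1 - x) * expR (2 * x).
have dh x : is_derive x (1 : R) h (1 - (1 - 2 * x) * expR (2 * x)).
  by rewrite /h; apply: is_derive_eq; rewrite /GRing.scale /=; ring.
have -> : 0 = h 0 :> R by rewrite /h mulr0 expR0; ring.
apply: (@ger0_derive1_ndecry _ h 0) => //.
- move=> x _; rewrite derive1E (@derive_val _ _ _ _ _ _ _ (dh x)) subr_ge0.
  by rewrite -ler_pdivlMr ?expR_gt0 // mul1r -expRN expR_ge1Dx.
- apply: continuous_subspaceT => x; apply: differentiable_continuous.
  by apply/derivable1_diffP; exact: ex_derive.
Qed.

(** The worst case is [x = 1/4 - y], where [x ^ 2 + y = (1/4 + y) ^ 2] and the
    claim is the square of [mobius_le_expR] at [4 * y]. *)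
Lemma sqr_le_expR_drift (R : realType) (x y : R) :
  0 <= y -> 0 <= x -> x <= 1 / 4 - y ->
  x ^+ 2 <= expR (- (16 * y)) * (x ^+ 2 + y).
Proof.
move=> y0 x0 xy; rewrite expRN mulrC ler_pdivlMr ?expR_gt0 //.
have yq : 0 <= 1 / 4 - y by lra.
have m : (1 / 4 - y) ^+ 2 * expR (16 * y) <= (1 / 4 + y) ^+ 2.
  have -> : 16 * y = 2 * (4 * y) + 2 * (4 * y) by ring.
  rewrite expRD; have := @mobius_le_expR _ (4 * y).
  rewrite mulr_ge0 // => /(_ isT).
  have := expR_gt0 (2 * (4 * y) : R); set e := expR _ => e0 h.
  have k0 : 0 <= (1 / 4 - y) * e by rewrite mulr_ge0 // ltW.
  have k : (1 / 4 - y) * e <= 1 / 4 + y by lra.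
  have := ler_pM k0 k0 k k.
  rewrite (_ : _ * e * (_ * e) = (1 / 4 - y) ^+ 2 * (e * e)) ?expr2 //; ring.
have xx : x ^+ 2 <= (1 / 4 - y) ^+ 2 by rewrite ler_pXn2r ?nnegrE.
have E1 : 0 <= expR (16 * y) - 1 :> R.
  by rewrite subr_ge0 -expR0 ler_expR mulr_ge0.
have := ler_wpM2r E1 xx; lra.
Qed.

Section SmallCuts.
Context {R : realType} {n : nat} (d : nat) (S : {set 'I_n}).
Hypotheses (d0 : (0 < d)%N) (n0 : (0 < n)%N).

Let M : R := (d * n)%:R.
Let a : R := #|S|%:R / n%:R.
Let b : R := #|~: S|%:R / n%:R.
(* Accounts for the choices that do not admit a switching, as
   [M * eps = 2 * d ^ 2]. *)
Let eps : R := 2 * d%:R / n%:R.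

Let dR : 0 < d%:R :> R. Proof. by rewrite ltr0n. Qed.
Let nR : 0 < n%:R :> R. Proof. by rewrite ltr0n. Qed.
Let ME : M = d%:R * n%:R. Proof. by rewrite /M natrM. Qed.
Let MR : 0 < M. Proof. by rewrite ME mulr_gt0. Qed.
Let a0 : 0 <= a. Proof. by rewrite divr_ge0. Qed.
Let b0 : 0 <= b. Proof. by rewrite divr_ge0. Qed.
Let eps0 : 0 <= eps. Proof. by rewrite divr_ge0 // mulr_ge0. Qed.
Let ab1 : a + b = 1.
Proof. by rewrite -mulrDl -natrD cardsC card_ord divff // gt_eqF. Qed.

(** With [x = (c + 2) / M], the two factors of [switching_inequality] are at
    least [M * (a - x)] and [M * (b - x - eps)]. As [a + b = 1], the product
    [(a - x) * (b - x)] is [x ^ 2 + (a * b - x)]. *)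
Lemma cut_class_drift c : c%:R + 2 <= M * (a * b - eps) ->
  #|cut_class d S c|%:R <=
   expR (- (16 * (a * b - eps - (c%:R + 2) / M)))
     * #|cut_class d S (c + 2)|%:R.
Proof.
move=> cM; pose x := (c%:R + 2) / M.
have xM : c%:R = M * x - 2 by rewrite mulrC divfK ?gt_eqF // addrK.
have x0 : 0 < x by rewrite divr_gt0 // ltr_wpDl.
have [y y0 yE] : exists2 y, 0 <= y & y = a * b - eps - x.
  by exists (a * b - eps - x) => //; rewrite subr_ge0 ler_pdivrMr // mulrC.
rewrite -/x -yE.
have abE : b = 1 - a by rewrite -ab1 addrC addKr.
have baE : a = 1 - b by rewrite -ab1 addrK.
have := switching_inequality R d S c.
set N := #|cut_class d S c|%:R; set N' := #|cut_class d S (c + 2)|%:R.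
have N0 : 0 <= N :> R by rewrite ler0n.
have N'0 : 0 <= N' :> R by rewrite ler0n.
have -> : (d * #|S|)%:R = M * a :> R.
  by rewrite natrM ME /a; field; rewrite gt_eqF.
have -> : (d * #|~: S|)%:R = M * b :> R.
  by rewrite natrM ME /b; field; rewrite gt_eqF.
have -> : 2 * d%:R ^+ 2 = M * eps.
  by rewrite ME /eps; field; rewrite gt_eqF.
rewrite xM subrK => sw.
have ax : 0 <= a - x.
  have -> : a - x = a ^+ 2 + eps + y by rewrite yE abE; ring.
  by rewrite !addr_ge0 ?sqr_ge0.
have bx : 0 <= b - x - eps.
  have -> : b - x - eps = b ^+ 2 + y by rewrite yE baE; ring.
  by rewrite addr_ge0 ?sqr_ge0.
have K : M ^+ 2 * (x ^+ 2 + y) <=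
    (M * a - (M * x - 2)) * (M * b - (M * x - 2) - M * eps).
  apply: (@le_trans _ _ ((M * (a - x)) * (M * (b - x - eps)))).
    rewrite (_ : M * _ * _ = M ^+ 2 * ((a - x) * (b - x - eps)));
      last by ring.
    rewrite ler_pM2l ?exprn_gt0 // -subr_ge0.
    have -> : (a - x) * (b - x - eps) - (x ^+ 2 + y) = eps * (b + x).
      by rewrite yE baE; ring.
    by rewrite mulr_ge0 // addr_ge0 // ltW.
  by apply: ler_pM; rewrite ?mulr_ge0 ?(ltW MR) // !mulrBr; lra.
have M2 : 0 < M ^+ 2 by rewrite exprn_gt0.
have sw2 : N * (x ^+ 2 + y) <= N' * x ^+ 2.
  rewrite -(ler_pM2l M2).
  have -> : M ^+ 2 * (N' * x ^+ 2) = N' * (M * x) ^+ 2 by ring.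
  apply: le_trans sw; rewrite mulrCA; exact: ler_wpM2l.
have xy : x ^+ 2 <= expR (- (16 * y)) * (x ^+ 2 + y).
  apply: sqr_le_expR_drift => //; [exact: ltW|].
  rewrite yE -subr_ge0.
  have -> : 1 / 4 - (a * b - eps - x) - x = (a - 1 / 2) ^+ 2 + eps.
    by rewrite abE; field.
  by rewrite addr_ge0 ?sqr_ge0.
have xy0 : 0 < x ^+ 2 + y by rewrite ltr_wpDr // exprn_gt0.
rewrite -(ler_pM2r xy0); apply: le_trans sw2 _.
by rewrite mulrAC [leRHS]mulrC; apply: ler_wpM2l.
Qed.

(** Graphs are collected up to a threshold because the ratio in
    [cut_class_drift] increases with [c], so that the bound at the threshold
    holds for all of them together. *)
Definition small_cut (t : R) : {set sgraph n} :=
  [set G | regular d G & (cut G S)%:R <= t]%SET.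

Lemma card_small_cut t K : (n * n <= K)%N ->
  #|small_cut t| = (\sum_(0 <= c < K.+1) (c%:R <= t)%R * #|cut_class d S c|)%N.
Proof.
move=> nK; have cutK G : (cut G S < K.+1)%N.
  rewrite ltnS; apply: leq_trans nK; rewrite /cut.
  apply: leq_trans (_ : \sum_(u in S) n <= _)%N; last first.
    by rewrite sum_nat_const leq_mul2r -[X in (_ <= X)%N]card_ord max_card orbT.
  apply: leq_sum => u _; rewrite -[leqRHS]card_ord -sum1_card.
  rewrite [leqRHS](bigID (mem (~: S))) /=.
  by apply: leq_trans (leq_addr _ _); apply: leq_sum => v _; case: adjacent.
rewrite -sum1_card big_mkord.
under [RHS]eq_bigr => c _ do rewrite -sum1_card big_distrr big_mkcond /=.
rewrite exchange_big [LHS]big_mkcond; apply: eq_bigr => G _ /=.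
rewrite (bigD1 (Ordinal (cutK G))) //= big1 ?addn0 => [|c cG].
  by rewrite !inE eqxx andbT; case: regular => //=; case: (_ <= t)%R.
case: ifP => //; rewrite inE => /andP[_ /eqP cutG].
by case/eqP: cG; apply: val_inj; rewrite /= cutG.
Qed.

Lemma small_cut_drift t : t + 2 <= M * (a * b - eps) ->
  #|small_cut t|%:R <=
   expR (- (16 * (a * b - eps - (t + 2) / M))) * #|small_cut (t + 2)|%:R.
Proof.
move=> tM; rewrite (@card_small_cut t (n * n)) //.
rewrite (@card_small_cut _ (n * n).+2) ?leqW //.
set E := expR _; have E0 : 0 <= E by exact: expR_ge0.
have recl2 (F : nat -> nat) m : (\sum_(0 <= c < m.+2) F c =
    F 0 + (F 1 + \sum_(0 <= c < m) F c.+2))%N.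
  by rewrite big_nat_recl // big_nat_recl.
rewrite [in leRHS]recl2 !natrD !mulrDr.
rewrite -[leLHS]add0r lerD ?mulr_ge0 // -[leLHS]add0r lerD ?mulr_ge0 //.
rewrite !natr_sum mulr_sumr; apply: ler_sum => c _.
rewrite -addn2 natrD lerD2r.
case: (leP c%:R t) => ct; last by rewrite !mul0n mulr0.
rewrite !mul1n; apply: le_trans (cut_class_drift _) _.
  by apply: le_trans tM; rewrite lerD2r.
rewrite ler_wpM2r // ler_expR lerN2 ler_pM2l // lerD2l lerN2.
by rewrite ler_pM2r ?invr_gt0 // lerD2r.
Qed.

(** The exponents form an arithmetic progression of step [2 / M], and
    [T * (T + 1) / M] is the sum of [2 * i / M] for [i] from 1 to [T]. *)
Lemma small_cut_drift_iter (T : nat) t : t + 2 * T%:R <= M * (a * b - eps) ->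
  #|small_cut t|%:R <=
   expR (- (16 * (T%:R * (a * b - eps - t / M) - T%:R * (T%:R + 1) / M)))
     * #|small_cut (t + 2 * T%:R)|%:R.
Proof.
elim: T t => [|T IHT] t.
  by rewrite !mul0r subr0 mulr0 oppr0 expR0 mul1r mulr0 addr0.
have -> : T.+1%:R = T%:R + 1 :> R by rewrite natr1.
move=> tM.
have T0 : 0 <= T%:R :> R by [].
apply: le_trans (small_cut_drift _) _; first by lra.
have tM' : t + 2 + 2 * T%:R <= M * (a * b - eps) by lra.
apply: le_trans (ler_wpM2l (expR_ge0 _) (IHT _ tM')) _.
rewrite mulrA -expRD.
have -> : t + 2 + 2 * T%:R = t + 2 * (T%:R + 1) by ring.
rewrite ler_wpM2r // ler_expR.
rewrite le_eqVlt; apply/orP; left; apply/eqP.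
by field; rewrite !gt_eqF.
Qed.

(** Iterate the drift from deviation [delta = Y - eps] down to 0, that is about
    [M * delta / 2] times. The exponents then sum to about
    [4 * M * delta ^ 2], and [4 * M * Y ^ 2 = n]; the constant
    [16 * (d ^ 2 + 1)] absorbs [eps] and the rounding of the number of steps. *)
Lemma small_cut_rare :
  #|small_cut (M * (a * b - 1 / (2 * Num.sqrt d%:R)))|%:R <=
  expR (16 * (d%:R ^+ 2 + 1) - n%:R)
    * #|[set G : sgraph n | regular d G]%SET|%:R :> R.
Proof.
set Y : R := 1 / (2 * Num.sqrt d%:R).
have small_le t :
    #|small_cut t|%:R <= #|[set G : sgraph n | regular d G]%SET|%:R :> R.
  rewrite ler_nat; apply/subset_leq_card/fintype.subsetP => G.
  by rewrite !inE => /andP[].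
have s1 : 1 <= Num.sqrt d%:R :> R by rewrite -[leLHS]sqrtr1 ler_sqrt // ler1n.
have s2 : Num.sqrt d%:R ^+ 2 = d%:R :> R by rewrite sqr_sqrtr.
have Y0 : 0 < Y by rewrite divr_gt0 // mulr_gt0 // (lt_le_trans _ s1).
have Y1 : Y <= 1 by rewrite ler_pdivrMr ?mulr_gt0 ?(lt_le_trans _ s1) //; lra.
have Y2 : 4 * M * Y ^+ 2 = n%:R.
  rewrite /Y ME -[in X in X * n%:R]s2; field.
  by rewrite gt_eqF // (lt_le_trans _ s1).
have Meps : M * eps = 2 * d%:R ^+ 2.
  by rewrite ME /eps; field; rewrite gt_eqF.
pose delta := Y - eps.
have d1 : 1 <= d%:R :> R by rewrite ler1n.
(* If [delta < 0], then [n] is so small that the exponential is at least 1. *)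
have [dneg|dpos] := ltP delta 0.
  apply: (le_trans (small_le _)).
  rewrite ler_peMl // -[leLHS]expR0 ler_expR subr_ge0.
  have : M * Y <= 2 * d%:R ^+ 2 by rewrite -Meps ler_pM2l // -subr_le0 ltW.
  have : 0 <= d%:R ^+ 2 :> R by rewrite exprn_ge0.
  rewrite -Y2; nra.
pose T := Num.trunc (M * delta / 2).
have /andP[T1 T2] : T%:R <= M * delta / 2 < T.+1%:R.
  by apply: truncn_itv; rewrite divr_ge0 // mulr_ge0 // ltW.
have {}T2 : M * delta / 2 < T%:R + 1 by rewrite natr1.
apply: le_trans (@small_cut_drift_iter T _ _) _.
  by rewrite -lerBrDl -mulrBr; rewrite /delta in T1; lra.
apply: ler_pM; rewrite ?expR_ge0 // ler_expR lerNl opprB.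
rewrite [M * (_ - Y)]mulrC mulfK ?gt_eqF //.
have -> : a * b - eps - (a * b - Y) = delta by rewrite /delta; ring.
have T0 : 0 <= T%:R :> R by [].
have -> : T%:R * delta - T%:R * (T%:R + 1) / M =
    T%:R * (M * delta - T%:R - 1) / M.
  by field; rewrite !gt_eqF.
rewrite mulrA lerBlDr.
(* The right-hand side is concave in [T]; it takes the value on the left at
   [M * delta / 2] and at one less, and [T] lies in between. *)
have quad : (M * delta / 2) ^+ 2 - M * delta / 2 <=
    T%:R * (M * delta - T%:R - 1).
  rewrite -subr_ge0.
  have -> : T%:R * (M * delta - T%:R - 1) -
      ((M * delta / 2) ^+ 2 - M * delta / 2) =
      (T%:R + 1 - M * delta / 2) * (M * delta / 2 - T%:R) by field.
  by apply: mulr_ge0; rewrite subr_ge0 //; exact: ltW.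
apply: (@le_trans _ _ (16 * ((M * delta / 2) ^+ 2 - M * delta / 2) / M +
    16 * (d%:R ^+ 2 + 1))); last first.
  by rewrite lerD2r ler_pM2r ?invr_gt0 // ler_pM2l.
have -> : 16 * ((M * delta / 2) ^+ 2 - M * delta / 2) / M =
    4 * M * Y ^+ 2 - 8 * Y * (M * eps) + 4 * M * eps ^+ 2 - 8 * delta.
  by rewrite /delta; field; rewrite !gt_eqF.
rewrite Y2 Meps.
have e0 := eps0; have ME0 : 0 <= 4 * M * eps ^+ 2.
  by rewrite !mulr_ge0 ?sqr_ge0 ?(ltW MR).
have dY : Y * d%:R ^+ 2 <= d%:R ^+ 2 by rewrite ler_piMl ?sqr_ge0.
have dd : delta <= 1 by rewrite /delta; lra.
by lra.
Qed.

End SmallCuts.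

(** * Existence of regular graphs *)

Section Circulant.
Context {m : nat}.
Local Notation Z := 'I_m.+1.

Lemma val_Zp_opp (x : Z) : x != 0 -> val (- x) = (m.+1 - x)%N.
Proof.
move=> x0; rewrite /= modn_small // ltn_subrL andbT lt0n.
by apply: contra x0 => /eqP x0; apply/eqP/val_inj.
Qed.

Lemma Zp_opp_fixed (x y : Z) : x != 0 -> y != 0 -> - x = x -> - y = y -> x = y.
Proof.
move=> x0 y0 /(congr1 val); rewrite val_Zp_opp // => xx.
move=> /(congr1 val); rewrite val_Zp_opp // => yy.
by apply: val_inj; have := ltn_ord x; have := ltn_ord y; move: xx yy => /=; lia.
Qed.

(** Add pairs [z], [- z] one at a time. Before each step at least two nonzero
    residues are left over, and at most one of them is its own opposite. For odd
    [d] start from the nonzero residue that is its own opposite, [m.+1 / 2],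
    which exists by the parity condition. *)
Lemma symmetric_set_exists d : (d < m.+1)%N -> (odd d -> ~~ odd m.+1) ->
  exists D : {set Z},
    [/\ 0 \notin D, forall x, x \in D -> - x \in D & #|D| = d].
Proof.
suff H k : (odd d + k.*2 < m.+1)%N -> (odd d -> ~~ odd m.+1) ->
    exists D : {set Z},
    [/\ 0 \notin D, forall x, x \in D -> - x \in D & #|D| = (odd d + k.*2)%N].
  by move=> dm; have := H d./2; rewrite odd_double_half => /(_ dm).
elim: k => [|k IHk] dm par.
  have [od|od] := boolP (odd d); last first.
    by exists finset.set0; split=> [|x|]; rewrite ?inE ?cards0 ?(negPf od).
  have m1 : (0 < m)%N by move: dm; rewrite od.
  have hm : (m.+1./2 < m.+1)%N.
    by rewrite -{2}[m.+1]odd_double_half -addnn; lia.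
  have h0 : Ordinal hm != 0 :> Z.
    by apply/eqP => /(congr1 val) /=; case: (m) m1.
  have hh : - (Ordinal hm : Z) = Ordinal hm.
    apply: val_inj; rewrite val_Zp_opp //=.
    by have := par od; rewrite -{2}[m.+1]odd_double_half => /negPf->; lia.
  exists [set Ordinal hm]%SET; split; last by rewrite cards1.
    by rewrite inE eq_sym.
  by move=> x; rewrite !inE => /eqP->; rewrite hh.
have [|D [D0 DN cD]] := IHk _ par.
  by apply: leq_ltn_trans dm; rewrite leq_add2l leq_double.
have : (1 < #|~: (0%R |: D)|)%N.
  have := cardsC (0%R |: D); rewrite cardsU1 D0 cD card_ord; move: dm.
  by rewrite doubleS; lia.
move=> /card_gt1P[x [y []]]; rewrite !inE !negb_or.
move=> /andP[x0 xD] /andP[y0 yD] xy.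
have [z [z0 zD zz]] : exists z : Z, [/\ z != 0, z \notin D & - z != z].
  have [xx|] := eqVneq (- x) x; last by exists x.
  have [yy|] := eqVneq (- y) y; last by exists y.
  by rewrite (Zp_opp_fixed x0 y0 xx yy) eqxx in xy.
have zND : - z \notin D by apply: contra zD => /DN; rewrite opprK.
exists (z |: (- z |: D))%SET; split.
- by rewrite !inE !negb_or eq_sym z0 D0 andbT eq_sym oppr_eq0.
- move=> w; rewrite !inE => /or3P[/eqP->|/eqP->|/DN->].
  + by rewrite eqxx orbT.
  + by rewrite opprK eqxx.
  + by rewrite !orbT.
- rewrite !cardsU1 cD zND !inE negb_or zD andbT eq_sym zz doubleS; lia.
Qed.

(** Join two residues when their difference lies in a symmetric set. *)
Lemma circulant_exists d : (d < m.+1)%N -> (odd d -> ~~ odd m.+1) ->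
  exists G : sgraph m.+1, regular d G.
Proof.
move=> dm par; have [D [D0 DN cD]] := symmetric_set_exists dm par.
have neqD (u v : Z) : v - u \in D -> u != v.
  by apply: contraTneq => ->; rewrite subrr.
pose E := [set [set p.1; p.2]%SET | p : Z * Z & p.2 - p.1 \in D]%SET.
have EP : [forall e in E, #|e| == 2].
  by apply/forall_inP => _ /imsetP[p /[!inE] /neqD pD ->]; rewrite cards2 pD.
exists (SGraph EP); apply/forallP => v; rewrite deg_row.
have adjE u : adjacent (SGraph EP) v u = (u - v \in D).
  apply/imsetP/idP => [[p /[!inE] pD /eqP]|uvD].
    rewrite set2_eq ?neqD // => /orP[]/andP[/eqP-> /eqP->] //.
    by rewrite -opprB DN.
  by exists (v, u); rewrite ?inE.
under eq_bigr => u _ do rewrite adjE.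
rewrite (reindex_inj (addrI v)) /= -[in X in _ == X]cD -sum1_card.
rewrite [X in _ == X]big_mkcond.
by apply/eqP/eq_bigr => u _; rewrite addrC addKr; case: (u \in D).
Qed.

End Circulant.

(** Without regular graphs the probability of every event would be 0. *)
Lemma regular_exists d n : (d < n)%N -> (odd d -> ~~ odd n) ->
  exists G : sgraph n, regular d G.
Proof. by case: n => // m; exact: circulant_exists. Qed.

(** * Random regular graphs *)

Section LargeModularity.
Context {R : realType} {n : nat}.
Implicit Types (G : sgraph n) (S : {set 'I_n}).

(** The typical cut of [S] is [d * n] times the product of the densities. The
    allowed relative deviation is a quarter of [2 / sqrt d], because
    [partition_sum_le_bipartition] loses a factor 4. *)
Definition cut_threshold (d : nat) S : R :=
  (d * n)%:R *
    (#|S|%:R / n%:R * (#|~: S|%:R / n%:R) - 1 / (2 * Num.sqrt d%:R)).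

Lemma sum_excess_cut d G S :
  \sum_(u in S) \sum_(v in ~: S) @excess R n d G u v =
  (cut G S)%:R / (d * n)%:R - #|S|%:R / n%:R * (#|~: S|%:R / n%:R).
Proof.
rewrite /excess.
under eq_bigr => u _ do rewrite big_split /= sumrN -mulr_suml sumr_const.
rewrite big_split /= sumrN -mulr_suml sumr_const; congr (_ / _ - _).
  by rewrite natr_sum; apply: eq_bigr => u _; rewrite natr_sum.
rewrite div1r -mulrnA -[LHS]mulr_natl natrM mulf_div [RHS]mulrC expr2.
by rewrite [in RHS]mulrC [#|~: S|%:R * _]mulrC.
Qed.

Lemma modularity_le_of_cuts d G : (0 < d)%N -> (0 < n)%N -> regular d G ->
  (forall S, G \notin small_cut d S (cut_threshold d S)) ->
  modularity R G <= 2 / Num.sqrt d%:R.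
Proof.
move=> d0 n0 Gd cuts.
have M0 : 0 < (d * n)%:R :> R by rewrite ltr0n muln_gt0 d0.
have s0 : 0 < Num.sqrt d%:R :> R by rewrite sqrtr_gt0 ltr0n.
suff H P : finset.partition P [set: 'I_n]%SET ->
    modularity_of R G P <= 2 / Num.sqrt d%:R.
  by apply: bigmax_le => [|P]; apply: H; exact: singletons_partition.
move=> partP; rewrite (modularity_of_regular P d0 n0 Gd).
have -> : 2 / Num.sqrt d%:R = 4 * (1 / (2 * Num.sqrt d%:R)) :> R.
  by field; rewrite gt_eqF.
apply: partition_sum_le_bipartition => // [|S].
  apply: big1 => u _; rewrite big_split /= sumrN -mulr_suml -natr_sum.
  rewrite (regular_row Gd) sumr_const card_ord natrM; field.
  by rewrite !pnatr_eq0 -!lt0n n0 d0.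
have := cuts S; rewrite inE Gd /= -ltNge /cut_threshold sum_excess_cut => cS.
by rewrite opprB lerBlDr -lerBlDl ler_pdivlMr // mulrC ltW.
Qed.

(** Union bound over all vertex sets. *)
Lemma large_modularity_rare d : (0 < d)%N -> (0 < n)%N ->
  #|[set G : sgraph n |
      regular d G & ~~ (modularity R G <= 2 / Num.sqrt d%:R)]%SET|%:R
  <= 2 ^+ n * (expR (16 * (d%:R ^+ 2 + 1) - n%:R) *
       #|[set G : sgraph n | regular d G]%SET|%:R) :> R.
Proof.
move=> d0 n0.
apply: (@le_trans _ _
  (\sum_(S : {set 'I_n}) #|@small_cut R n d S (cut_threshold d S)|%:R)).
  rewrite -natr_sum ler_nat.
  apply: leq_trans
    (_ : #|\bigcup_S @small_cut R n d S (cut_threshold d S)| <= _)%N.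
    apply/subset_leq_card/fintype.subsetP => G; rewrite inE => /andP[Gd].
    apply: contraNT => /bigcupP noS; apply: modularity_le_of_cuts => // S.
    by apply/negP => GS; apply: noS; exists S.
  apply: (big_ind2 (fun (A : {set sgraph n}) k => #|A| <= k)%N).
  - by rewrite cards0.
  - move=> A k B l Ak Bl.
    exact: leq_trans (leq_card_setU A B) (leq_add Ak Bl).
  - by [].
have -> : 2 ^+ n = #|{set 'I_n}|%:R :> R.
  by rewrite -cardsT -powersetT card_powerset cardsT card_ord natrX.
rewrite mulr_natl -sumr_const; apply: ler_sum => S _.
exact: small_cut_rare.
Qed.

End LargeModularity.

(** The failure probability is at most a constant times [(2 / e) ^ n], and
    [e >= (1 + 1/2) ^ 2 > 2]. *)
Lemma aas_modularity (R : realType) d : (0 < d)%N ->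
  aas_regular R d (fun n G => modularity R G <= 2 / Num.sqrt d%:R).
Proof.
move=> d0; rewrite /aas_regular.
pose C : R := expR (16 * (d%:R ^+ 2 + 1)).
pose q : R := 2 * expR (- 1).
have q1 : `|q| < 1.
  rewrite ger0_norm ?mulr_ge0 ?expR_ge0 // /q expRN.
  rewrite ltr_pdivrMr ?expR_gt0 // mul1r.
  have -> : 1 = 1 / 2 + 1 / 2 :> R by field.
  rewrite expRD; have := @expR_ge1Dx R (1 / 2); nra.
apply: (@squeeze_cvgr _ _ _ _ (fun n => 1 - geometric C q n) (fun=> 1));
  last 2 first.
- apply: cvg_within_filter.
  have := cvgB (cvg_cst (1 : R)) (cvg_geometric C q1).
  by rewrite subr0; apply.
- exact: cvg_cst.
rewrite near_withinE; near=> n => par.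
have dn : (d < n)%N by near: n; exact: nbhs_infty_gt.
have n0 : (0 < n)%N by exact: leq_ltn_trans dn.
pose N : R := #|[set G : sgraph n | regular d G]%SET|%:R.
have N0 : 0 < N.
  rewrite ltr0n; apply/card_gt0P; have [G Gd] := regular_exists dn par.
  by exists G; rewrite inE.
pose E := [set G : sgraph n | modularity R G <= 2 / Num.sqrt d%:R]%SET.
have NE : N = #|[set G : sgraph n | regular d G & G \in E]%SET|%:R +
    #|[set G : sgraph n | regular d G & G \notin E]%SET|%:R.
  rewrite -natrD /N -(cardsID E); congr (_ + _)%:R.
    by congr #|pred_of_set _|; apply/finset.setP => G; rewrite !inE.
  by congr #|pred_of_set _|; apply/finset.setP => G; rewrite !inE andbC.
have := large_modularity_rare (R := R) d0 n0; rewrite -/N.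
have -> : [set G : sgraph n |
      regular d G & ~~ (modularity R G <= 2 / Num.sqrt d%:R)]%SET
    = [set G : sgraph n | regular d G & G \notin E]%SET.
  by apply/finset.setP => G; rewrite !inE.
have -> :
    Pr_regular R d (fun G : sgraph n => modularity R G <= 2 / Num.sqrt d%:R) =
    #|[set G : sgraph n | regular d G & G \in E]%SET|%:R / N.
  rewrite /Pr_regular; congr (_%:R / _).
  by congr #|pred_of_set _|; apply/finset.setP => G; rewrite !inE.
move=> rare; rewrite ler_pdivlMr // ler_pdivrMr // mul1r {2}NE.
rewrite lerDl ler0n andbT.
rewrite mulrBl mul1r lerBlDr {1}NE lerD2l; apply: le_trans rare _.
rewrite mulrA ler_pM2r // expRD -mulrN1 (expRM_natl n) /= /q exprMn -/C.
by rewrite mulrCA.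
Unshelve. all: by end_near.
Qed.

Theorem theorem4 (R : realType) (d : nat) (hd : (3 <= d)%N) :
  (forall (n : nat) (G : sgraph n), regular d G ->
     modularity R G <= lambda R G / d%:R)
  /\ aas_regular R d (fun n G => modularity R G <= 2 / Num.sqrt d%:R).
Proof.
split; first by move=> n G; exact: modularity_le_lambda.
by apply: aas_modularity; exact: leq_trans hd.
Qed.
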